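(* Let $r>0$ and $\alpha>0$, and let $$E(r,\alpha)=\left\{x\in(0,1]:\lim_{n\to\infty}\frac{L_n(x)}{n^r}=\alpha\right\},\qquad L_n(x)=\max\{d_i(x):1\le i\le n\}.$$ Then $$\dim_{\mathrm{H}}E(r,\alpha)=\begin{cases}1, & \text{if } r<1,\\ 0, & \text{if } r\ge 1.\end{cases}$$
   Context: $\mathbb{N}=\{1,2,3,\dots\}$; $\dim_{\mathrm{H}}$ denotes Hausdorff dimension. Every $x\in(0,1]$ has a unique expansion $x=\sum_{i=1}^{\infty}2^{-(d_1(x)+d_2(x)+\cdots+d_i(x))}$ with all $d_i(x)\in\mathbb{N}$ (the power-2-decaying Gauss-like expansion); this defines the digit functions $d_i:(0,1]\to\mathbb{N}$. Equivalently, with $T:(0,1]\to(0,1]$ given by $Tx=2^nx-1$ for $x\in(2^{-n},2^{-(n-1)}]$, $n\in\mathbb{N}$, the digit $d_i(x)$ is the unique $n\in\mathbb{N}$ with $T^{i-1}x\in(2^{-n},2^{-(n-1)}]$. *)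

(* Defs.v *)
From mathcomp Require Import all_boot all_order all_algebra.
From mathcomp Require Import all_classical all_reals all_analysis.
From mathcomp Require Import ring lra.

Set Implicit Arguments.
Unset Strict Implicit.
Unset Printing Implicit Defensive.

Import Order.TTheory GRing.Theory Num.Theory.
Import numFieldNormedType.Exports.

Local Open Scope classical_set_scope.
Local Open Scope ring_scope.

Section HausdorffDimension.
Context {R : realType}.
Implicit Types (A : set R) (s delta : R).

(* The added point 0 only matters for the empty set, whose diameter is 0. *)
Definition diam A : \bar R :=
  ereal_sup (0%E |` [set `|x - y|%:E | x in A & y in A]).

(* |A|^s, with the usual convention that the empty set contributes 0 even
   when s = 0; a nonempty set of diameter 0 contributes 1 when s = 0. *)
Definition diam_pow s A : \bar R :=
  if A == set0 then 0%E else poweR (diam A) s.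

Definition delta_covers delta A : set ((set R)^nat) :=
  [set U | A `<=` \bigcup_k U k /\ forall k, (diam (U k) <= delta%:E)%E].

Definition hausdorff_content s delta A : \bar R :=
  ereal_inf [set (\sum_(0 <= k <oo) diam_pow s (U k))%E
            | U in delta_covers delta A].

Definition hausdorff_measure s A : \bar R :=
  ereal_sup [set hausdorff_content s delta A | delta in [set delta | 0 < delta]].

Definition hausdorff_dim A : \bar R :=
  ereal_inf [set s%:E | s in [set s | 0 <= s /\ hausdorff_measure s A = 0%E]].

End HausdorffDimension.

Section GaussLikeExpansion.
Context {R : realType}.
Implicit Types x : R.

(* Only meaningful for 0 < x <= 1, where such an n exists and is unique
   (lemmas digit1P and digit1_uniq); the same proviso applies below. *)
Definition digit1 x : nat :=
  get [set n : nat | (0 < n)%N /\ 2 ^- n < x <= 2 ^- n.-1].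

Definition gaussT x : R := 2 ^+ digit1 x * x - 1.

(* Digits are numbered from i = 1. *)
Definition digit (i : nat) x : nat := digit1 (iter i.-1 gaussT x).

Definition maxdigit (n : nat) x : nat := \max_(1 <= i < n.+1) digit i x.

Definition E (r alpha : R) : set R :=
  [set x | 0 < x <= 1 /\
    (maxdigit n x)%:R / n%:R `^ r @[n --> \oo] --> alpha].

(* The sequence d is numbered from 0 here: d i stands for d_{i+1}(x). *)
Definition is_expansion (d : nat -> nat) x : Prop :=
  (forall i, (0 < d i)%N) /\
  [series (2 ^- (\sum_(j < i.+1) d j) : R)]_i @ \oo --> x.

Lemma digit1P x : 0 < x <= 1 ->
  (0 < digit1 x)%N /\ 2 ^- digit1 x < x <= 2 ^- (digit1 x).-1.
Proof.
move=> /andP[x0 x1].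
suff : [set n : nat | (0 < n)%N /\ 2 ^- n < x <= 2 ^- n.-1] (digit1 x) by [].
apply: getPex.
have ex : exists n : nat, 2 ^- n < x.
  have [n] : exists n : nat, x^-1 < n%:R.
    by exists (Num.truncn x^-1).+1; apply: truncnS_gt.
  move=> xn; exists n.
  rewrite invf_plt ?posrE ?exprn_gt0// (lt_le_trans xn)//.
  by rewrite -natrX ler_nat ltnW// ltn_expl.
have [n xn minn] := ex_minnP ex.
have n0 : (0 < n)%N.
  by case: n xn {minn} => // ; rewrite expr0 invr1 ltNge x1.
exists n; split => //; rewrite xn/= leNgt; apply/negP => /minn.
by rewrite leqNgt prednK// leqnn.
Qed.

Lemma digit1_uniq x (n : nat) : (0 < n)%N -> 2 ^- n < x <= 2 ^- n.-1 ->
  digit1 x = n.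
Proof.
have aux (m k : nat) : (0 < k)%N -> 2 ^- m < x -> x <= 2 ^- k.-1 -> (k <= m)%N.
  case: k => // k _ mx xk; rewrite ltnNge; apply/negP => mk.
  have := lt_le_trans mx xk; rewrite ltf_pV2 ?posrE ?exprn_gt0//.
  by rewrite ltNge ler_weXn2l// ler1n.
move=> n0 /andP[nx xn].
have /digit1P[d0 /andP[dx xd]] : 0 < x <= 1.
  rewrite (lt_trans _ nx) ?invr_gt0 ?exprn_gt0//= (le_trans xn)//.
  by rewrite invf_le1 ?exprn_gt0// exprn_ege1// ler1n.
by apply/eqP; rewrite eqn_leq; apply/andP; split; apply: aux.
Qed.

Lemma gaussT_range x : 0 < x <= 1 -> 0 < gaussT x <= 1.
Proof.
move=> /digit1P; rewrite /gaussT; case: (digit1 x) => [[]//|n [_ /andP[nx xn]]].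
have p0 (m : nat) : (0 : R) < 2 ^+ m by rewrite exprn_gt0.
have lb : 1 < 2 ^+ n.+1 * x by rewrite -ltr_pdivrMl// mulr1.
have ub : 2 ^+ n * x <= 1 by rewrite -ler_pdivlMl// mulr1.
by rewrite subr_gt0 lb/= lerBlDl exprS -mulrA; lra.
Qed.

Lemma iter_gaussT_range n x : 0 < x <= 1 -> 0 < iter n gaussT x <= 1.
Proof. by move=> x01; elim: n => //= n; exact: gaussT_range. Qed.

Lemma digit_expansion x : 0 < x <= 1 -> is_expansion (fun i => digit i.+1 x) x.
Proof.
move=> x01.
have d_gt0 i : (0 < digit i.+1 x)%N.
  by have [] := digit1P (iter_gaussT_range i x01).
split=> //.
pose S n := (\sum_(j < n) digit j.+1 x)%N.
have partial n : [series (2 ^- S i.+1 : R)]_i n = x - 2 ^- S n * iter n gaussT x.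
  rewrite /series/=; elim: n => [|n IHn].
    by rewrite big_nil /S big_ord0 expr0 invr1 mul1r subrr.
  have Srec : S n.+1 = (S n + digit1 (iter n gaussT x))%N.
    by rewrite /S big_ord_recr.
  rewrite big_nat_recr//= IHn Srec.
  rewrite [gaussT (iter _ _ _)]/gaussT exprD invfM.
  set y := iter n gaussT x; set k := digit1 y.
  have := mulVf (lt0r_neq0 (exprn_gt0 k (ltr0n R 2))).
  move: (2 ^+ k : R) (2 ^- k : R) (2 ^- S n : R) => c b a bc.
  have -> : a * b * (c * y - 1) = a * (b * c) * y - a * b by ring.
  by rewrite bc; ring.
have nS n : (n <= S n)%N.
  elim: n => // n IHn; have := leq_add IHn (d_gt0 n).
  by rewrite addn1 /S big_ord_recr.
have rem0 : (2 ^- S n * iter n gaussT x : R) @[n --> \oo] --> 0.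
  apply: (@squeeze_cvgr _ _ _ _ (fun=> 0) (fun n => (2^-1 : R) ^+ n)).
  - near=> n; have /andP[y0 y1] := iter_gaussT_range n x01.
    rewrite mulr_ge0 ?invr_ge0 ?exprn_ge0 ?(ltW y0)//=.
    rewrite -[leRHS]mulr1 ler_pM ?invr_ge0 ?exprn_ge0 ?(ltW y0)//.
    by rewrite exprVn lef_pV2 ?posrE ?exprn_gt0// ler_weXn2l// ler1n.
  - exact: cvg_cst.
  - by apply: cvg_expr; rewrite gtr0_norm ?invr_gt0// invf_lt1// ltr1n.
rewrite (_ : [series _]_i = (fun n => x - 2 ^- S n * iter n gaussT x)); last first.
  by apply/funext => n; rewrite -partial.
by rewrite -[X in _ --> X]subr0; apply: cvgB => //; exact: cvg_cst.
Unshelve. all: by end_near. Qed.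

Lemma expansion_step (d : nat -> nat) x : is_expansion d x ->
  [/\ digit1 x = d 0%N & is_expansion (fun i => d i.+1) (gaussT x)].
Proof.
move=> [d0 dx].
pose u (e : nat -> nat) := fun i => (2 ^- (\sum_(j < i.+1) e j) : R).
pose d' i := d i.+1.
have k0 : (2 : R) ^+ d 0%N != 0 by rewrite expf_neq0.
pose y := 2 ^+ d 0%N * x - 1.
have partial n : series (u d') n = 2 ^+ d 0%N * series (u d) n.+1 - 1.
  have u0 : u d 0%N = 2 ^- d 0%N by rewrite /u big_ord1.
  have uS i : u d i.+1 = 2 ^- d 0%N * u d' i.
    by rewrite /u big_ord_recl exprD invfM.
  rewrite /series/= big_nat_recl// u0 mulrDr mulfV// addrC addKr.
  rewrite mulr_sumr; apply: eq_bigr => i _.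
  by rewrite uS mulrA mulfV// mul1r.
have dy : series (u d') @ \oo --> y.
  rewrite (_ : series _ = (fun n => 2 ^+ d 0%N * series (u d) n.+1 - 1)); last first.
    exact/funext.
  apply: cvgB; last exact: cvg_cst.
  apply: cvgM; first exact: cvg_cst.
  by rewrite (cvg_shiftS (series (u d))).
have y_gt0 : 0 < y.
  rewrite -(cvg_lim _ dy)//.
  have : series (u d') 1 <= limn (series (u d')).
    apply: nondecreasing_cvgn_le; last by apply/cvg_ex; exists y.
    apply: nondecreasing_series => i _ _.
    by rewrite invr_ge0 exprn_ge0.
  apply: lt_le_trans.
  by rewrite /series/= big_nat1 invr_gt0 exprn_gt0.
have y_le1 : y <= 1.
  rewrite -(cvg_lim _ dy)//; apply: limr_le; first by apply/cvg_ex; exists y.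
  near=> n.
  suff : series (u d') n <= 1 - 2^-1 ^+ n.
    by move/le_trans; apply; rewrite gerBl exprn_ge0// invr_ge0.
  elim: (n) => [|m IHm]; first by rewrite /series/= big_nil expr0 subrr.
  rewrite /series/= big_nat_recr//=.
  suff : u d' m <= 2^-1 ^+ m.+1.
    move: IHm; rewrite /series/= exprS; lra.
  rewrite exprVn lef_pV2 ?posrE ?exprn_gt0// ler_weXn2l ?ler1n//.
  rewrite -[leqLHS]muln1 -[X in (X * _)%N]card_ord -sum_nat_const.
  by apply: leq_sum => i _; exact: d0.
have xE : x = 2 ^- d 0%N * (1 + y).
  by rewrite /y addrC subrK mulrA mulVf// mul1r.
have dE : digit1 x = d 0%N.
  apply: digit1_uniq => //.
  have p0 : (0 : R) < 2 ^- d 0%N by rewrite invr_gt0 exprn_gt0.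
  have -> : (2 : R) ^- (d 0%N).-1 = 2 ^- d 0%N * 2.
    by rewrite -{2}(prednK (d0 0%N)) exprSr invfM -mulrA mulVf ?mulr1.
  by rewrite xE ltr_pMr// ler_pM2l//; apply/andP; split; lra.
split=> //; rewrite /gaussT dE.
by split => [i|]; [exact: d0|exact: dy].
Unshelve. all: by end_near. Qed.

Lemma expansion_uniq (d : nat -> nat) x : is_expansion d x ->
  forall i, d i = digit i.+1 x.
Proof.
move=> dx i; elim: i d x dx => [|i IHi] d x /expansion_step[d0 dT].
  by rewrite -d0.
by rewrite (IHi _ _ dT) /digit/= -iterSr.
Qed.

End GaussLikeExpansion.

(* Main.v *)
(** A digit of size [d] is a run of [d - 1] zeros in the binary expansion of
    [x].

    Case [r >= 1]. Between [j m] and [(j + 1) m] the maximum must strictly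
    increase for all [J <= j < 2 J] once [m] is large, so the first [2 J m]
    digits contain [J] digits of size at least [alpha J m / 2]; hence the digit
    sums grow faster than every multiple of [n] along a subsequence, the density
    of ones in the binary expansion vanishes, and counting dyadic intervals gives
    dimension 0.

    Case [r < 1]. Points [y] whose [n]-th digit is at most [2 log_2 n + O(1)] form
    a set of positive Lebesgue outer measure. Adding to the digits of [y] a fixed
    sequence [a] that vanishes off a sparse set, whose running maximum is
    [~ alpha n^r] and whose partial sums are [o(n)], produces a point of
    [E r alpha]; the inverse map is s-Hoelder for every [s < 1] because the
    digit sums of both points agree up to [o(n)]. *)
Require Import Defs.
From mathcomp Require Import all_boot all_order all_algebra.
From mathcomp Require Import all_classical all_reals all_analysis.
From mathcomp Require Import ring lra zify.
Import Order.TTheory GRing.Theory Num.Theory.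
Import numFieldNormedType.Exports.
Local Open Scope ring_scope.

Set Implicit Arguments.
Unset Strict Implicit.
Unset Printing Implicit Defensive.

(** * Hausdorff content: countable subadditivity, Hoelder maps, comparison with Lebesgue measure *)

Section HausdorffContent.
Context {R : realType}.
Local Open Scope classical_set_scope.
Implicit Types (A B : set R) (s delta : R).

Lemma diam_ge0 A : (0 <= diam A)%E.
Proof. by apply: ereal_sup_ubound; left. Qed.

Lemma diam_ub A (d : \bar R) : (0 <= d)%E ->
  (forall x y, A x -> A y -> ((`|x - y|)%:E <= d)%E) -> (diam A <= d)%E.
Proof.
move=> d0 Ad; apply: ge_ereal_sup => _ [->//|[x Ax [y Ay <-]]].
exact: Ad.
Qed.

Lemma dist_le_diam A x y : A x -> A y -> ((`|x - y|)%:E <= diam A)%E.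
Proof.
by move=> Ax Ay; apply: ereal_sup_ubound; right; exists x => //; exists y.
Qed.

Lemma diam_set0 : diam (@set0 R) = 0%E.
Proof. by apply/eqP; rewrite eq_le diam_ge0 diam_ub. Qed.

Lemma diam_pow_ge0 s A : (0 <= diam_pow s A)%E.
Proof. by rewrite /diam_pow; case: ifPn => // _; exact: poweR_ge0. Qed.

Lemma diam_pow_set0 s : diam_pow s (@set0 R) = 0%E.
Proof. by rewrite /diam_pow eqxx. Qed.

Lemma diam_pow_le s A (d : R) : 0 <= s -> 0 <= d -> (diam A <= d%:E)%E ->
  (diam_pow s A <= (d `^ s)%:E)%E.
Proof.
move=> s0 d0 Ad; rewrite /diam_pow; case: ifPn => _.
  by rewrite lee_fin powR_ge0.
rewrite -poweR_EFin; apply: gt0_ler_poweR => //.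
- by rewrite in_itv/= diam_ge0 leey.
- by rewrite in_itv/= lee_fin d0 leey.
Qed.

Lemma hausdorff_content_ge0 s delta A : (0 <= hausdorff_content s delta A)%E.
Proof.
apply: le_ereal_inf_tmp => _ [U _ <-].
by apply: nneseries_ge0 => k _ _; exact: diam_pow_ge0.
Qed.

Lemma hausdorff_content_cover s delta A (U : (set R)^nat) :
  delta_covers delta A U ->
  (hausdorff_content s delta A <= \sum_(0 <= k <oo) diam_pow s (U k))%E.
Proof. by move=> AU; apply: ereal_inf_lbound; exists U. Qed.

Lemma hausdorff_content_mono s delta A B : A `<=` B ->
  (hausdorff_content s delta A <= hausdorff_content s delta B)%E.
Proof.
move=> AB; apply: le_ereal_inf_tmp => _ [U [BU Ud] <-].
by apply: hausdorff_content_cover; split=> //; exact: subset_trans BU.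
Qed.

Lemma hausdorff_content_le_measure s delta A : 0 < delta ->
  (hausdorff_content s delta A <= hausdorff_measure s A)%E.
Proof. by move=> d0; apply: ereal_sup_ubound; exists delta. Qed.

Lemma hausdorff_measure_eq0 s A :
  (forall delta, 0 < delta -> hausdorff_content s delta A = 0%E) ->
  hausdorff_measure s A = 0%E.
Proof.
move=> A0; apply/eqP; rewrite eq_le; apply/andP; split.
  by apply: ge_ereal_sup => _ [delta d0 <-]; rewrite A0.
by rewrite -(A0 1)//; exact: hausdorff_content_le_measure.
Qed.

(** Each [A i] gets a cover that is optimal up to [e / 2 ^ i.+1]; the double sequence of covers is
    enumerated by a bijection between [nat] and [nat * nat]. *)
Lemma hausdorff_content_sigma_subadditive s delta (A : (set R)^nat) :
  (hausdorff_content s delta (\bigcup_i A i) <=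
   \sum_(0 <= i <oo) hausdorff_content s delta (A i))%E.
Proof.
set H := hausdorff_content s delta.
have H0 B : (0 <= H B)%E by exact: hausdorff_content_ge0.
(* A term [+oo] makes the right side infinite; otherwise all contents are finite, as near-optimal
   covers require. *)
have [[i ioo]|Aoo] := pselect (exists i, H (A i) = +oo%E).
  rewrite (eseries_pinfty _ _ ioo) ?leey// => n _.
  by rewrite -ltNye (lt_le_trans _ (H0 _)).
apply/lee_addgt0Pr => e e0.
apply: le_trans (epsilon_trick _ _ (ltW e0)); last by move=> n; exact: H0.
have [G PG] : {G : ((set R)^nat)^nat & forall n, delta_covers delta (A n) (G n) /\
   (\sum_(0 <= k <oo) diam_pow s (G n k) <= H (A n) + (e / (2 ^ n.+1)%:R)%:E)%E}.
  pose P n U := delta_covers delta (A n) U /\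
    (\sum_(0 <= k <oo) diam_pow s (U k) <= H (A n) + (e / (2 ^ n.+1)%:R)%:E)%E.
  apply: (@choice _ _ P) => n.
  have fA : H (A n) \is a fin_num.
    by rewrite ge0_fin_numE// ltey; apply/eqP => Hn; apply: Aoo; exists n.
  have en : 0 < e / (2 ^ n.+1)%:R by rewrite divr_gt0// ltr0n expn_gt0.
  have [_ [U AU <-] /ltW] := lb_ereal_inf_adherent en fA.
  by exists U.
have /card_esym/ppcard_eqP[f] := card_nat2.
have GP p : (0 <= diam_pow s (uncurry G p))%E by exact: diam_pow_ge0.
apply: (@le_trans _ _ (\sum_(0 <= k <oo) diam_pow s (uncurry G (f k))))%E.
  apply: hausdorff_content_cover; split=> [x [i _ Ax]|k].
    have [[+ _] _] := PG i => /(_ x Ax)[j _ Gx].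
    by exists (f^-1%FUN (i, j)) => //=; rewrite invK ?inE.
  by case: (f k) => i j; case: (PG i) => -[_ +] _; apply.
rewrite nneseries_esumT; last by move=> k; exact: GP.
rewrite -(@reindex_esum _ _ _ setT setT f (diam_pow s \o uncurry G)); last first.
- exact: 'bij_f.
have -> : (\esum_(p in [set: nat * nat]) (diam_pow s \o uncurry G) p =
    \esum_(i in [set: nat]) \esum_(j in [set: nat]) diam_pow s (G i j))%E.
  rewrite esum_esum; last by move=> i j _ _; exact: diam_pow_ge0.
  have -> : [set: nat] `*`` (fun=> [set: nat]) = setT.
    by apply/seteqP; split=> // -[].
  by apply: eq_esum => -[].
rewrite [leRHS]nneseries_esumT; last first.
  by move=> n; rewrite adde_ge0// lee_fin divr_ge0// ltW.
apply: le_esum => i _.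
rewrite -nneseries_esumT; last by move=> j; exact: diam_pow_ge0.
by case: (PG i).
Qed.

Lemma hausdorff_content_bigcup_eq0 s delta (A : (set R)^nat) :
  (forall i, hausdorff_content s delta (A i) = 0%E) ->
  hausdorff_content s delta (\bigcup_i A i) = 0%E.
Proof.
move=> A0; apply/eqP; rewrite eq_le hausdorff_content_ge0 andbT.
by rewrite (le_trans (hausdorff_content_sigma_subadditive _ _ _))// eseries0.
Qed.

Lemma hausdorff_content_set0 s delta : 0 <= delta ->
  hausdorff_content s delta (@set0 R) = 0%E.
Proof.
move=> d0; apply/eqP; rewrite eq_le hausdorff_content_ge0 andbT.
apply: le_trans (hausdorff_content_cover _ (U := fun=> set0) _) _.
  by split=> // k; rewrite diam_set0 lee_fin.
by rewrite eseries0// => k _ _; exact: diam_pow_set0.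
Qed.

Lemma hausdorff_contentU s delta A B : 0 <= delta ->
  (hausdorff_content s delta (A `|` B) <=
   hausdorff_content s delta A + hausdorff_content s delta B)%E.
Proof.
move=> d0; rewrite -bigcup2E.
apply: le_trans (hausdorff_content_sigma_subadditive _ _ _) _.
have H0 C : (0 <= hausdorff_content s delta C)%E by exact: hausdorff_content_ge0.
rewrite (nneseries_split 0 2)//.
rewrite eseries0; last by case=> [|[|k]]//= _ _; exact: hausdorff_content_set0.
by rewrite adde0 !big_nat_recl//= big_nil adde0.
Qed.

Lemma hausdorff_content_le_pow s delta A (d : R) : 0 <= s -> 0 <= d <= delta ->
  (diam A <= d%:E)%E -> (hausdorff_content s delta A <= (d `^ s)%:E)%E.
Proof.
move=> s0 /andP[d0 dd] Ad.
apply: le_trans (hausdorff_content_cover _ (U := bigcup2 A set0) _) _.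
  split=> [x Ax|[|[|k]]]/=.
  - by exists 0%N.
  - by rewrite (le_trans Ad)// lee_fin.
  - by rewrite diam_set0 lee_fin (le_trans d0).
  - by rewrite diam_set0 lee_fin (le_trans d0).
rewrite nneseries_recl//; last by move=> k _; exact: diam_pow_ge0.
rewrite eseries0; last by case=> [|[|k]]//= _ _; exact: diam_pow_set0.
by rewrite adde0 diam_pow_le.
Qed.

Lemma hausdorff_content_anti s delta delta' A : delta <= delta' ->
  (hausdorff_content s delta' A <= hausdorff_content s delta A)%E.
Proof.
move=> dd; apply: le_ereal_inf_tmp => _ [U [AU Ud] <-].
apply: hausdorff_content_cover; split=> // k.
by rewrite (le_trans (Ud k))// lee_fin.
Qed.

(** The inverse of [g] is [a]-Hoelder on [B], so a cover [U] of [A] pulls back to a cover of [B]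
    whose diameters are at most [C] times the [a]-th powers of those of [U]. The case [a = 1] serves
    affine maps, the case [a < 1] the lower bound for the dimension. *)
Lemma hausdorff_content_holder (a u C delta delta' : R) A B (g : R -> R) :
  0 <= a -> 0 <= u -> 0 < C -> C * delta `^ a <= delta' ->
  (forall y, B y -> A (g y)) ->
  (forall y y', B y -> B y' -> `|y - y'| <= C * `|g y - g y'| `^ a) ->
  (hausdorff_content u delta' B <=
   (C `^ u)%:E * hausdorff_content (a * u) delta A)%E.
Proof.
move=> a0 u0 C0 dd' BA gP.
have Cu : 0 < C `^ u by rewrite powR_gt0.
rewrite -lee_pdivrMl//; apply: le_ereal_inf_tmp => _ [U [AU Ud] <-].
rewrite lee_pdivrMl// -nneseriesZl; last by move=> k _; exact: diam_pow_ge0.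
pose V k := B `&` g @^-1` U k.
have finU k : diam (U k) = (fine (diam (U k)))%:E.
  by rewrite fineK// ge0_fin_numE ?diam_ge0// (le_lt_trans (Ud k))// ltry.
have diamU k : 0 <= fine (diam (U k)) <= delta.
  by rewrite -!lee_fin -finU diam_ge0 Ud.
have diamV k : (diam (V k) <= (C * fine (diam (U k)) `^ a)%:E)%E.
  have /andP[D0 _] := diamU k.
  apply: diam_ub => [|y y' [By Uy] [By' Uy']].
    by rewrite lee_fin mulr_ge0 ?powR_ge0 ?ltW.
  rewrite lee_fin (le_trans (gP _ _ By By'))// ler_pM2l//.
  by apply: ge0_ler_powR => //; rewrite ?nnegrE// -lee_fin -finU dist_le_diam.
apply: le_trans (hausdorff_content_cover _ (U := V) _) _.
  split=> [y By|k].
    by have [k _ Uk] := AU _ (BA _ By); exists k.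
  rewrite (le_trans (diamV k))// lee_fin (le_trans _ dd')// ler_pM2l//.
  have /andP[D0 Dd] := diamU k.
  by apply: ge0_ler_powR => //; rewrite ?nnegrE// (le_trans D0).
apply: lee_nneseries => [k *|k _]; first exact: diam_pow_ge0.
(* An empty [V k] contributes 0 by convention; a nonempty one forces [U k] to be nonempty, so both
   terms are genuine powers, also for exponent 0. *)
have [->|/set0P[y [By Uy]]] := eqVneq (V k) set0.
  by rewrite diam_pow_set0 mule_ge0 ?diam_pow_ge0// lee_fin ltW.
have /andP[D0 _] := diamU k.
apply: le_trans (diam_pow_le u0 _ (diamV k)) _.
  by rewrite mulr_ge0 ?powR_ge0 ?ltW.
rewrite /diam_pow ifF; last by apply/negbTE/set0P; exists (g y).
by rewrite finU poweR_EFin -EFinM powRM ?powR_ge0 ?(ltW C0)// powRrM.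
Qed.

(** The closed interval from the infimum to the supremum of a covering set is no longer than its
    diameter, so Lebesgue measure bounds the sum of diameters from below. *)
Lemma hausdorff_content_itv01 delta :
  (1 <= hausdorff_content 1 delta [set x : R | (0 < x <= 1)%R])%E.
Proof.
apply: le_ereal_inf_tmp => _ [U [AU Ud] <-].
pose I k : set R := if U k == set0 then set0 else `[inf (U k), sup (U k)]%classic.
have mI k : measurable (I k) by rewrite /I; case: ifP.
have UI k x : U k x -> I k x /\ sup (U k) - inf (U k) <= fine (diam (U k)).
  move=> Ux.
  have finU : diam (U k) = (fine (diam (U k)))%:E.
    by rewrite fineK// ge0_fin_numE ?diam_ge0// (le_lt_trans (Ud k))// ltry.
  have Uy y z : U k y -> U k z -> `|y - z| <= fine (diam (U k)).
    by move=> Uy Uz; rewrite -lee_fin -finU; exact: dist_le_diam.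
  rewrite /I ifF; last by apply/negbTE/set0P; exists x.
  split.
    rewrite /= in_itv/=; apply/andP; split.
      apply: ge_inf => //; exists (x - fine (diam (U k))) => y Uy0.
      by have := Uy _ _ Ux Uy0; rewrite ler_norml; lra.
    apply: ub_le_sup => //; exists (x + fine (diam (U k))) => y Uy0.
    by have := Uy _ _ Ux Uy0; rewrite ler_norml; lra.
  rewrite lerBlDr; apply: ge_sup; first by exists x.
  move=> y Uy0; rewrite -lerBlDl; apply: lb_le_inf; first by exists x.
  by move=> z Uz; have := Uy _ _ Uy0 Uz; rewrite ler_norml; lra.
have lebI k : (lebesgue_measure (I k) <= diam_pow 1 (U k))%E.
  rewrite /I /diam_pow; case: ifPn => [_|/set0P[x Ux]]; first by rewrite measure0.
  have [_ Ub] := UI _ _ Ux.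
  rewrite poweRe1 ?diam_ge0// lebesgue_measure_itv/=; case: ifPn => _.
    rewrite -EFinB (le_trans (y := (fine (diam (U k)))%:E)) ?lee_fin//.
    by rewrite fineK// ge0_fin_numE ?diam_ge0// (le_lt_trans (Ud k))// ltry.
  exact: diam_ge0.
have -> : (1 = lebesgue_measure (`]0%R, 1%R]%classic : set R))%E.
  by rewrite lebesgue_measure_itv/= lte_fin ltr01 oppr0 adde0.
apply: (@le_trans _ _ (\sum_(0 <= k <oo) lebesgue_measure (I k))%E).
  apply: measure_sigma_subadditive => //.
  move=> x; rewrite /= in_itv/= => x01.
  by have [k _ /UI[Ik _]] := AU _ x01; exists k.
by apply: lee_nneseries => k *; [exact: measure_ge0|exact: lebI].
Qed.

End HausdorffContent.

(** * Distances between points in terms of digits, and contents of sets given by digit conditions *)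

Definition digit_sum (R : realType) (n : nat) (x : R) : nat :=
  \sum_(i < n) digit i.+1 x.

Section Digits.
Context {R : realType}.
Local Open Scope classical_set_scope.
Implicit Types (x y delta : R).

Lemma gaussTK x : x = 2 ^- digit1 x * (1 + gaussT x).
Proof. by rewrite /gaussT addrC subrK mulKf// expf_neq0. Qed.

Lemma digitS i x : digit i.+2 x = digit i.+1 (gaussT x).
Proof. by rewrite /digit/= -iterSr. Qed.

Lemma digit_gt0 i x : 0 < x <= 1 -> (0 < digit i.+1 x)%N.
Proof. by move=> x01; have [] := digit1P (iter_gaussT_range i x01). Qed.

Lemma digit_sumS n x :
  digit_sum n.+1 x = (digit1 x + digit_sum n (gaussT x))%N.
Proof.
rewrite /digit_sum big_ord_recl; congr (_ + _)%N.
by apply: eq_bigr => i _; rewrite -digitS.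
Qed.

Lemma digit_sum_ge n x : 0 < x <= 1 -> (n <= digit_sum n x)%N.
Proof.
elim: n x => // n IHn x x01; rewrite digit_sumS -add1n leq_add//.
  exact: (digit_gt0 0 x01).
by rewrite IHn// gaussT_range.
Qed.

(** Where first digits agree, [gaussT] is affine with slope [2 ^+ digit1 x]; after [n] applications
    both points are still in the unit interval. *)
Lemma dist_common_digits n x y : 0 < x <= 1 -> 0 < y <= 1 ->
  (forall i, (i < n)%N -> digit i.+1 x = digit i.+1 y) ->
  `|x - y| <= 2 ^- digit_sum n x.
Proof.
elim: n x y => [|n IHn] x y x01 y01 xy.
  by rewrite /digit_sum big_ord0 expr0 invr1 ler_norml; move: x01 y01; lra.
have xy0 : digit1 x = digit1 y by exact: (xy 0%N).
rewrite [in `|_|](gaussTK x) [in `|_|](gaussTK y) -xy0 -mulrBr.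
rewrite opprD addrACA subrr add0r digit_sumS exprD invfM normrM.
rewrite ger0_norm ?invr_ge0 ?exprn_ge0// ler_pM2l ?invr_gt0 ?exprn_gt0//.
by apply: IHn; rewrite ?gaussT_range// => i ni; rewrite -!digitS xy.
Qed.

(** A smaller digit means a larger point. Once the common digits are removed, [y] is at most the
    left endpoint of the branch containing [x], and the next digit of [x] bounds the distance of [x]
    to this endpoint from below; hence [n.+2]. *)
Lemma dist_first_diff n x y : 0 < x <= 1 -> 0 < y <= 1 ->
  (forall i, (i < n)%N -> digit i.+1 x = digit i.+1 y) ->
  (digit n.+1 x < digit n.+1 y)%N ->
  2 ^- digit_sum n.+2 x <= x - y.
Proof.
elim: n x y => [|n IHn] x y x01 y01 xy dxy.
  rewrite [in leRHS](gaussTK x) !digit_sumS addnA exprD.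
  rewrite /digit_sum big_ord0 expr0 mulr1 exprD invfM.
  have [_ /andP[_ ylt]] := digit1P y01.
  have [_ /andP[Txgt _]] := digit1P (gaussT_range x01).
  have yx : y <= 2 ^- digit1 x.
    rewrite (le_trans ylt)// lef_pV2 ?posrE ?exprn_gt0//.
    rewrite ler_weXn2l ?ler1n//.
    by move: dxy; rewrite /digit/=; case: (digit1 y).
  rewrite mulrDr mulr1 addrAC ler_wpDl ?subr_ge0//.
  by rewrite ler_pM2l ?invr_gt0 ?exprn_gt0// ltW.
have xy0 : digit1 x = digit1 y by exact: (xy 0%N).
rewrite [in leRHS](gaussTK x) [in leRHS](gaussTK y) -xy0 -mulrBr.
rewrite opprD addrACA subrr add0r digit_sumS exprD invfM.
rewrite ler_pM2l ?invr_gt0 ?exprn_gt0//.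
by apply: IHn; rewrite ?gaussT_range -?digitS// => i ni; rewrite -!digitS xy.
Qed.

Lemma digit_inj x y : 0 < x <= 1 -> 0 < y <= 1 ->
  (forall i, digit i.+1 x = digit i.+1 y) -> x = y.
Proof.
move=> x01 y01 xy.
have dxy : (fun i => digit i.+1 x) = (fun i => digit i.+1 y) by exact/funext.
have [_ ycv] := digit_expansion y01.
have := digit_expansion x01; rewrite dxy => -[_ xcv].
exact: cvg_unique xcv ycv.
Qed.

(** Digits at least 1 make the series dominated by a geometric one of sum 1, and its first term
    keeps the limit positive. *)
Lemma expansion_exists (d : nat -> nat) : (forall i, (0 < d i)%N) ->
  exists2 x : R, 0 < x <= 1 & is_expansion d x.
Proof.
move=> d0.
pose u i := (2 ^- (\sum_(j < i.+1) d j) : R).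
have u_gt0 i : 0 < u i by rewrite invr_gt0 exprn_gt0.
have u_le i : u i <= 2^-1 ^+ i.+1.
  rewrite exprVn lef_pV2 ?posrE ?exprn_gt0// ler_weXn2l ?ler1n//.
  rewrite -[leqLHS]muln1 -[X in (X * _)%N]card_ord -sum_nat_const.
  by apply: leq_sum => j _; exact: d0.
have su_le n : series u n <= 1.
  suff : series u n <= 1 - 2^-1 ^+ n.
    by move/le_trans; apply; rewrite gerBl exprn_ge0// invr_ge0.
  elim: n => [|m IHm]; first by rewrite /series/= big_nil expr0 subrr.
  rewrite /series/= big_nat_recr//=.
  by move: IHm (u_le m); rewrite /series/= exprS; lra.
have su_nd : nondecreasing_seq (series u).
  by apply: nondecreasing_series => i _ _; exact: ltW.
have su_cv : cvgn (series u).
  by apply: nondecreasing_is_cvgn => //; exists 1 => _ [n _ <-].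
exists (limn (series u)); last by split.
apply/andP; split.
  have : series u 1 <= limn (series u) by exact: nondecreasing_cvgn_le.
  by apply: lt_le_trans; rewrite /series/= big_nat1.
by apply: limr_le => //; apply: nearW.
Qed.

(* The binary expansion of such an [x] has at most [n] ones among its first [m]
   digits. Splitting on the first binary digit, [1] consumes one of the [n]
   allowed ones, at the price of a factor [tau]. *)
Lemma digit_sum_cover (s tau : R) (m n : nat) : 0 <= s -> 1 <= tau ->
  (hausdorff_content s (2 ^- m)
     [set x | (0 < x <= 1)%R /\ (m <= digit_sum n x)%N] <=
   ((2^-1 `^ s * (1 + tau^-1)) ^+ m * tau ^+ n)%:E)%E.
Proof.
move=> s0 tau1.
have tau0 : 0 < tau by rewrite (lt_le_trans _ tau1).
elim: m n => [|m IHm] n.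
  rewrite expr0 invr1 mul1r.
  apply: (@le_trans _ _ (1 `^ s)%:E).
    apply: hausdorff_content_le_pow => //; first by rewrite ler01 lexx.
    apply: diam_ub => [|x y [x01 _] [y01 _]]; first by rewrite lee_fin.
    by rewrite lee_fin ler_norml; move: x01 y01; lra.
  by rewrite powR1 lee_fin exprn_ege1.
case: n => [|n].
  rewrite (_ : [set x | _] = set0).
    rewrite hausdorff_content_set0 ?invr_ge0 ?exprn_ge0//.
    by rewrite lee_fin mulr_ge0 ?exprn_ge0 ?mulr_ge0 ?powR_ge0 ?addr_ge0
      ?invr_ge0 ?ltW.
  by apply/seteqP; split=> // x [_]; rewrite /digit_sum big_ord0.
set B := [set x | _].
have half x y : `|x - y| <= 2^-1 * `|2 * x - 2 * y| `^ 1.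
  by rewrite powRr1// -mulrBr normrM ger0_norm// mulKf.
have -> : B = (B `&` [set x | x <= 2^-1]) `|` (B `&` [set x | 2^-1 < x]).
  rewrite -setIUr (_ : _ `|` _ = setT) ?setIT//.
  by apply/seteqP; split=> // x _; case: (leP x 2^-1); [left|right].
have d0 : (0 : R) <= 2 ^- m.+1 by rewrite invr_ge0 exprn_ge0.
have dE : (2^-1 : R) * (2 ^- m) `^ 1 <= 2 ^- m.+1.
  by rewrite powRr1 ?invr_ge0 ?exprn_ge0// exprS invfM.
apply: le_trans (hausdorff_contentU _ _ _ d0) _.
have IH1 : (hausdorff_content s (2 ^- m.+1) (B `&` [set x | (x <= 2^-1)%R]) <=
  (2^-1 `^ s * ((2^-1 `^ s * (1 + tau^-1)) ^+ m * tau ^+ n.+1))%:E)%E.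
  apply: le_trans (@hausdorff_content_holder _ 1 s _ _ _ _ _ (fun x => 2 * x)
    ler01 s0 _ dE _ _) _ => //; last first.
    by rewrite mul1r EFinM lee_pmul2l ?fin_numE ?lte_fin ?powR_gt0.
  move=> x [[x01 xm] /= x12].
  have x01' : 0 < 2 * x <= 1 by move: x01; lra.
  (* Doubling a point of the left half lowers its first digit by one and leaves [gaussT], hence all
     later digits, unchanged. *)
  have [e0 /andP[e1 e2]] := digit1P x01'.
  have dx : digit1 x = (digit1 (2 * x)).+1.
    apply: digit1_uniq => //=; rewrite exprS invfM.
    rewrite ltr_pdivrMl// e1/=; move: e2; rewrite -{2}(prednK e0) exprS invfM.
    by lra.
  split=> //; move: xm; rewrite !digit_sumS dx addSn ltnS.
  by rewrite /gaussT dx exprSr -mulrA.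
have IH2 : (hausdorff_content s (2 ^- m.+1) (B `&` [set x | (2^-1 < x)%R]) <=
  (2^-1 `^ s * ((2^-1 `^ s * (1 + tau^-1)) ^+ m * tau ^+ n))%:E)%E.
  apply: le_trans (@hausdorff_content_holder _ 1 s _ _ _ _ _ (fun x => 2 * x - 1)
    ler01 s0 _ dE _ _) _ => //; last first.
  - by rewrite mul1r EFinM lee_pmul2l ?fin_numE ?lte_fin ?powR_gt0.
  - by move=> x y _ _; rewrite opprB addrA subrK half.
  move=> x [[x01 xm] /= x12].
  have dx : digit1 x = 1%N.
    by apply: digit1_uniq => //=; rewrite expr1 expr0 invr1; move: x01; lra.
  have Tx : gaussT x = 2 * x - 1 by rewrite /gaussT dx.
  by split; [rewrite -Tx gaussT_range|move: xm; rewrite digit_sumS dx Tx].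
apply: le_trans (leeD IH1 IH2) _; rewrite -EFinD lee_fin.
rewrite [(2^-1 `^ s * _) ^+ m.+1]exprS [tau ^+ n.+1]exprS.
move: (2^-1 `^ s) (_ ^+ m) (tau ^+ n) => p q w.
suff -> : p * (q * (tau * w)) + p * (q * w) = p * (1 + tau^-1) * q * (tau * w) by [].
by field; rewrite gt_eqF.
Qed.

(* Lebesgue outer measure, in the guise of [hausdorff_content 1], does not
   increase under preimages by [gaussT]. *)
Lemma large_digit_content delta n (b : nat) : 1 <= delta ->
  (hausdorff_content 1 delta [set x : R | (0 < x <= 1)%R /\ (b < digit n.+1 x)%N]
   <= (2 ^- b)%:E)%E.
Proof.
move=> d1; have d0 : 0 <= delta by rewrite (le_trans _ d1).
elim: n => [|n IHn].
  rewrite -[X in (_ <= X%:E)%E]powRr1 ?invr_ge0 ?exprn_ge0//.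
  have b0 : (0 : R) <= 2 ^- b by rewrite invr_ge0 exprn_ge0.
  apply: hausdorff_content_le_pow => //.
    by rewrite b0 (le_trans _ d1)// invf_le1 ?exprn_gt0// exprn_ege1// ler1n.
  have H x : 0 < x <= 1 -> (b < digit 1 x)%N -> 0 < x <= (2 ^- b : R).
    move=> x01 bx; have [_ /andP[_ xd]] := digit1P x01.
    have /andP[-> _] := x01; rewrite (le_trans xd)// lef_pV2 ?posrE ?exprn_gt0//.
    by rewrite ler_weXn2l ?ler1n//; move: bx; rewrite /digit/=; case: digit1.
  apply: diam_ub => [|x y [x01 bx] [y01 b_y]]; first by rewrite lee_fin.
  by rewrite lee_fin ler_norml; move: (H _ x01 bx) (H _ y01 b_y); lra.
(* On the points with first digit [k.+1], [gaussT] is affine with slope [2 ^+ k.+1]; the resulting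
   weights [2 ^- k.+1] sum to 1. *)
set A := [set x | _]; pose D k := A `&` [set x | digit1 x = k.+1].
apply: (@le_trans _ _ (hausdorff_content 1 delta (\bigcup_k D k))).
  apply: hausdorff_content_mono => x Ax; exists (digit1 x).-1 => //.
  by split=> //=; rewrite prednK//; have [] := digit1P Ax.1.
apply: le_trans (hausdorff_content_sigma_subadditive _ _ _) _.
have b0 : (0 : R) <= 2 ^- b by rewrite invr_ge0 exprn_ge0.
apply: le_trans (@epsilon_trick0 R _ xpredT b0).
apply: lee_nneseries => [k *|k _]; first exact: hausdorff_content_ge0.
have k0 : (0 : R) < 2 ^- k.+1 by rewrite invr_gt0 exprn_gt0.
apply: le_trans (@hausdorff_content_holder _ 1 1 (2 ^- k.+1) delta delta
  [set x : R | 0 < x <= 1 /\ (b < digit n.+1 x)%N] _ gaussT ler01 ler01 k0 _ _ _) _.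
- by rewrite powRr1// ler_piMl// invf_le1 ?exprn_gt0// exprn_ege1// ler1n.
- by move=> x [[x01 bx] _]; split; [exact: gaussT_range|rewrite -digitS].
- move=> x y [_ /= xk] [_ /= yk]; rewrite powRr1// [in leLHS](gaussTK x).
  rewrite [in leLHS](gaussTK y) xk yk -mulrBr opprD addrACA subrr add0r normrM.
  by rewrite (ger0_norm (ltW k0)).
by rewrite mulr1 powRr1 ?(ltW k0)// natrX mulrC EFinM lee_pmul2l//.
Qed.

(** Union bound: the points left out have content at most the sum of the [2 ^- b i], and the whole
    unit interval has content at least 1. *)
Lemma bounded_digits_content delta (b : nat -> nat) (c : R) : 1 <= delta ->
  (forall n, \sum_(0 <= i < n) 2 ^- b i <= c) ->
  ((1 - c)%:E <= hausdorff_content 1 delta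
    [set x : R | (0 < x <= 1)%R /\ forall i, (digit i.+1 x <= b i)%N])%E.
Proof.
move=> d1 bc; have d0 : 0 <= delta by rewrite (le_trans _ d1).
set Y := [set x | _].
pose A i := [set x : R | (0 < x <= 1)%R /\ (b i < digit i.+1 x)%N].
rewrite EFinB leeBlDr//; apply: le_trans (hausdorff_content_itv01 delta) _.
apply: (@le_trans _ _ (hausdorff_content 1 delta (Y `|` \bigcup_i A i))).
  apply: hausdorff_content_mono => x x01.
  have [Yx|] := pselect (forall i, (digit i.+1 x <= b i)%N); first by left.
  by move/existsNP => [i /negP]; rewrite -ltnNge => bi; right; exists i.
apply: le_trans (hausdorff_contentU _ _ _ d0) _; rewrite leeD2l//.
apply: le_trans (hausdorff_content_sigma_subadditive _ _ _) _.
apply: (@le_trans _ _ (\sum_(0 <= i <oo) (2 ^- b i)%:E)%E).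
  apply: lee_nneseries => [k *|k _]; first exact: hausdorff_content_ge0.
  exact: large_digit_content.
apply: lime_le; first by apply: is_cvg_nneseries => n _ _; rewrite lee_fin invr_ge0 exprn_ge0.
by apply: nearW => n; rewrite sumEFin lee_fin.
Qed.

End Digits.

(** * Upper bounds for the dimension, and the case [1 <= r] *)

Section UpperBounds.
Context {R : realType}.
Local Open Scope classical_set_scope.
Implicit Types (x y r alpha s : R) (A : set R).

Lemma powR_gt1 (a p : R) : 1 < a -> 0 < p -> 1 < a `^ p.
Proof.
move=> a1 p0; have a0 : 0 <= a by rewrite (le_trans _ (ltW a1)).
by rewrite -{1}(congr1 (@^~ p) (@powR1 R)); apply: gt0_ltr_powR; rewrite ?nnegrE.
Qed.

Lemma digit_sum_cover_subset s tau m n A : 0 <= s -> 1 <= tau ->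
  (forall x, A x -> 0 < x <= 1 /\ (m <= digit_sum n x)%N) ->
  (hausdorff_content s (2 ^- m) A <=
   (((2 `^ s)^-1 * (1 + tau^-1)) ^+ m * tau ^+ n)%:E)%E.
Proof.
move=> s0 tau1 Amn.
rewrite -powRN -mulN1r powRrM powR_inv1//; apply: le_trans (digit_sum_cover m n s0 tau1).
exact: hausdorff_content_mono.
Qed.

Lemma hausdorff_dim_le s A : 0 <= s ->
  (forall t, s < t -> hausdorff_measure t A = 0%E) -> (hausdorff_dim A <= s%:E)%E.
Proof.
move=> s0 At; apply/lee_addgt0Pr => e e0; apply: ereal_inf_lbound.
by exists (s + e) => //; split; [lra|apply: At; lra].
Qed.

Lemma hausdorff_dim_ge s A :
  (forall t, 0 <= t < s -> hausdorff_measure t A != 0%E) -> (s%:E <= hausdorff_dim A)%E.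
Proof.
move=> At; apply: le_ereal_inf_tmp => _ [t [t0 At0] <-]; rewrite lee_fin leNgt.
by apply/negP => ts; have := At t; rewrite t0 ts At0 eqxx => /(_ isT).
Qed.

Lemma hausdorff_dim_ge0 A : (0 <= hausdorff_dim A)%E.
Proof. by apply: le_ereal_inf_tmp => _ [t [t0 _] <-]. Qed.

(** The scales [2 ^- k m] drop below any [delta], and content only decreases when larger covering
    sets are allowed; then [q ^+ m] tends to 0. *)
Lemma hausdorff_content_geometric_eq0 s (q delta : R) (k : nat -> nat) N A :
  0 <= q < 1 -> 0 < delta -> (forall m, (m <= k m)%N) ->
  (forall m, (N <= m)%N -> (hausdorff_content s (2 ^- k m) A <= (q ^+ m)%:E)%E) ->
  hausdorff_content s delta A = 0%E.
Proof.
move=> /andP[q0 q1] d0 mk Aq; apply/eqP; rewrite eq_le hausdorff_content_ge0 andbT.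
apply/lee_addgt0Pr => e e0; rewrite add0e.
have small (p c : R) : 0 <= p < 1 -> 0 < c -> \forall m \near \oo, p ^+ m < c.
  move=> /andP[p0 p1] c0.
  have /cvgr0_norm_lt/(_ _ c0) : (p ^+ m) @[m --> \oo] --> (0 : R).
    by apply: cvg_expr; rewrite ger0_norm.
  by apply: filterS => m; rewrite ger0_norm ?exprn_ge0.
near \oo => m.
have qm : q ^+ m < e by near: m; apply: small => //; rewrite q0.
have dm : 2^-1 ^+ m < delta by near: m; apply: small => //; rewrite invr_ge0 ler0n/=; lra.
have Nm : (N <= m)%N by near: m; exact: nbhs_infty_ge.
apply: (@le_trans _ _ (q ^+ m)%:E); last by rewrite lee_fin ltW.
apply: le_trans (Aq _ Nm); apply: hausdorff_content_anti.
apply: le_trans (ltW dm).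
by rewrite exprVn lef_pV2 ?posrE ?exprn_gt0// ler_weXn2l// ler1n.
Unshelve. all: by end_near. Qed.

(** With [tau = 1] and [n = m] the covering lemma restricts nothing, as [m] digits sum to at least
    [m]; its ratio 2^(1 - s) is below 1 for [1 < s]. *)
Lemma hausdorff_dim_le1 A : (forall x, A x -> 0 < x <= 1) -> (hausdorff_dim A <= 1)%E.
Proof.
move=> A01; apply: hausdorff_dim_le => // s s1.
have s0 : 0 <= s by rewrite (le_trans _ (ltW s1)).
apply: hausdorff_measure_eq0 => delta d0.
apply: (@hausdorff_content_geometric_eq0 s ((2 `^ s)^-1 * 2) delta id 0) => //.
  rewrite mulr_ge0 ?invr_ge0 ?powR_ge0//= mulrC ltr_pdivrMr ?powR_gt0// mul1r.
  rewrite -(subrK 1 s) powRD ?pnatr_eq0 ?implybT// powRr1// ltr_pMl//.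
  by rewrite powR_gt1 ?ltr1n ?subr_gt0.
move=> m _; rewrite -[X in X%:E]mulr1 -[X in _ * X](expr1n _ m).
have := @digit_sum_cover_subset s 1 m m A s0 (lexx 1); rewrite invr1; apply.
by move=> x /A01 x01; split=> //; exact: digit_sum_ge.
Qed.

Lemma maxdigitE n x : maxdigit n x = (\max_(i < n) digit i.+1 x)%N.
Proof. by rewrite /maxdigit big_add1 big_mkord. Qed.

(** A strict increase of the running maximum comes from a digit after position [n1] that equals the
    new maximum, so it adds to [digit_sum n1 x]. *)
Lemma digit_sum_record n1 n2 x : (n1 <= n2)%N ->
  (maxdigit n1 x < maxdigit n2 x)%N ->
  (digit_sum n1 x + maxdigit n2 x <= digit_sum n2 x)%N.
Proof.
elim: n2 => [|n IHn]; first by rewrite leqn0 => /eqP ->; rewrite ltnn.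
rewrite leq_eqVlt => /predU1P[->|]; first by rewrite ltnn.
rewrite ltnS => n1n; move: (IHn n1n); rewrite !maxdigitE.
have : (digit_sum n1 x <= digit_sum n x)%N.
  rewrite /digit_sum -(subnKC n1n) big_split_ord/= leq_addr //.
rewrite [digit_sum n.+1 x]/digit_sum !big_ord_recr/= -/(digit_sum n x).
move: (\max_(i < n) _)%N (\max_(i < n1) _)%N (digit n.+1 x) => M M1 d.
by lia.
Qed.

(** Monotonicity of t^(r - 1), cleared of denominators. *)
Lemma powR_superlinear r (a b : R) : 1 <= r -> 0 < a <= b ->
  b * a `^ r <= a * b `^ r.
Proof.
move=> r1 /andP[a0 ab]; have b0 := lt_le_trans a0 ab.
have r0 : 0 < r by rewrite (lt_le_trans _ r1).
rewrite -(mulr_powRB1 (ltW a0) r0) -(mulr_powRB1 (ltW b0) r0).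
rewrite mulrCA ler_pM2l// ler_pM2l//.
by apply: ge0_ler_powR; rewrite ?subr_ge0 ?nnegrE// ltW.
Qed.

Lemma digit_sum_superlinear r alpha (J K : nat) x : 1 <= r -> 0 < alpha ->
  (0 < J)%N -> 4 * K%:R <= alpha * J%:R -> E r alpha x ->
  exists N, forall m, (N <= m)%N ->
    (K * (2 * J * m) <= digit_sum (2 * J * m) x)%N.
Proof.
move=> r1 al0 J0 KJ [x01 Lcv].
have J0R : (0 : R) < J%:R by rewrite ltr0n.
(* The relative error must satisfy [eta * (2 * j + 1) <= 1] for [j < 2 * J], so that the ranges of
   [maxdigit] at [j * m] and [j.+1 * m] separate. *)
pose eta : R := (4 * J%:R)^-1.
have eta0 : 0 < eta by rewrite invr_gt0 mulr_gt0.
have etaJ : eta * J%:R = 4^-1 by rewrite /eta; field; rewrite gt_eqF.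
have /cvgrPdist_lt/(_ _ (mulr_gt0 al0 eta0))[N _ LN] := Lcv.
exists N.+1 => m Nm.
have m0 : (0 : R) < m%:R by rewrite ltr0n (leq_trans _ Nm).
have L n : (0 < n)%N -> alpha * (1 - eta) * (n * m)%:R `^ r < (maxdigit (n * m) x)%:R
    < alpha * (1 + eta) * (n * m)%:R `^ r.
  move=> n0; have nm0 : 0 < (n * m)%:R `^ r.
    by rewrite powR_gt0// ltr0n muln_gt0 n0 (leq_trans _ Nm).
  rewrite -(ltr_pdivlMr _ _ nm0) -(ltr_pdivrMr _ _ nm0).
  have : (N <= n * m)%N by rewrite (leq_trans (ltnW Nm))// leq_pmull.
  by move/LN; rewrite /= ltr_norml; lra.
(* Each of the [J] blocks contributes a record digit of size at least [v], where 1/2 absorbs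
   [1 - eta]; by [KJ], [J%:R * v] is at least [K * (2 * J * m)]. *)
pose v := alpha / 2 * (J%:R * m%:R).
suff step t : (t <= J)%N -> t%:R * v <= (digit_sum ((J + t) * m) x)%:R.
  have := step J (leqnn _); rewrite addnn -mul2n -(ler_nat R) => /(le_trans _); apply.
  rewrite !natrM /v; have := ler_wpM2l (ltW (mulr_gt0 J0R m0)) KJ.
  by lra.
elim: t => [|t IHt tJ]; first by rewrite mul0r.
have := IHt (ltnW tJ); set j := (J + t)%N => IH.
have j0 : (0 < j)%N by rewrite addn_gt0 J0.
have /andP[_ Lj] := L _ j0; have /andP[Lj1 _] := L j.+1 isT.
have jJ : j.+1%:R <= 2 * J%:R :> R.
  by rewrite -natrM ler_nat /j; lia.
have Jj : J%:R <= j.+1%:R :> R by rewrite ler_nat /j; lia.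
have j0R : (0 : R) < j%:R by rewrite ltr0n.
have jS : j.+1%:R = j%:R + 1 :> R by rewrite natr1.
have jm0 : 0 < (j * m)%:R :> R by rewrite natrM mulr_gt0.
have P0 : 0 < (j * m)%:R `^ r by rewrite powR_gt0.
have PQ : j.+1%:R * (j * m)%:R `^ r <= j%:R * (j.+1 * m)%:R `^ r.
  have : (0 : R) < (j * m)%:R <= ((j.+1 * m)%:R : R).
    by rewrite jm0/= ler_nat leq_mul2r leqnSn orbT.
  move/(powR_superlinear r1); rewrite [in X in X <= _]natrM [in X in _ <= X]natrM.
  rewrite ![_ * m%:R]mulrC -!mulrA ler_pM2l//.
have Qge : (j.+1 * m)%:R <= (j.+1 * m)%:R `^ r.
  rewrite -[leLHS]powRr1//; apply: ler_powR => //.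
  by rewrite ler1n muln_gt0 (leq_trans _ Nm).
have Lmm : (maxdigit (j * m) x < maxdigit (j.+1 * m) x)%N.
  rewrite -(ltr_nat R); apply: lt_trans Lj _; apply: le_lt_trans Lj1.
  rewrite -!mulrA ler_pM2l//.
  set P := _ `^ r in PQ P0 *; set Q := _ `^ r in PQ *.
  have e1 : eta * j.+1%:R <= 2^-1 by nra.
  have e2 : eta * (j%:R + j.+1%:R) <= 1 by nra.
  (* After multiplication by [j], [PQ] reduces the comparison to
     [(1 + eta) * j <= (1 - eta) * (j + 1)], which is [e2]. *)
  rewrite -(ler_pM2l j0R); apply: (@le_trans _ _ ((1 - eta) * (j.+1%:R * P))).
    by nra.
  by rewrite [leRHS]mulrCA ler_wpM2l//; nra.
have nn : (j * m <= j.+1 * m)%N by rewrite leq_mul2r leqnSn orbT.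
rewrite addnS -/j; have := digit_sum_record nn Lmm.
rewrite -(ler_nat R) natrD => /(le_trans _); apply.
rewrite -natr1 mulrDl mul1r lerD//; apply: le_trans (ltW Lj1).
have e1 : eta * j.+1%:R <= 2^-1 by nra.
have e3 : 2^-1 <= 1 - eta by nra.
rewrite /v -mulrA -[leRHS]mulrA ler_pM2l//; apply: ler_pM => //.
by apply: le_trans Qge; rewrite natrM ler_pM2r.
Qed.

Lemma hausdorff_dim_superlinear r alpha : 1 <= r -> 0 < alpha ->
  hausdorff_dim (E r alpha) = 0%E.
Proof.
move=> r1 al0; apply/eqP; rewrite eq_le hausdorff_dim_ge0 andbT.
apply: hausdorff_dim_le => // s s0; apply: hausdorff_measure_eq0 => delta d0.
pose w : R := 2 `^ (s / 2).
have w1 : 1 < w by rewrite powR_gt1 ?ltr1n// divr_gt0.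
have w0 : 0 < w by rewrite (lt_trans _ w1).
have wsE : 2 `^ s = w * w.
  by rewrite -powRD ?pnatr_eq0 ?implybT//; congr powR; field.
(* Chosen so that [1 + tau^-1 <= w], which makes the ratio [c] at most [w^-1 < 1]; the maximum with
   1 meets the hypothesis of the covering lemma. *)
pose tau := Num.max 1 (w - 1)^-1.
have tau1 : 1 <= tau by rewrite le_max lexx.
have tau0 : 0 < tau by rewrite (lt_le_trans _ tau1).
have tauw : tau^-1 <= w - 1.
  by rewrite invf_ple ?posrE ?subr_gt0// le_max lexx orbT.
pose c := (2 `^ s)^-1 * (1 + tau^-1).
have c01 : 0 <= c < 1.
  rewrite /c mulr_ge0 ?invr_ge0 ?powR_ge0 ?addr_ge0 ?invr_ge0 ?(ltW tau0)//=.
  by rewrite mulrC ltr_pdivrMr ?powR_gt0// wsE; nra.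
(* [K] is an average digit size at which the gain [c ^+ K] beats the cost [tau] of one digit. *)
have [K K0 cK] : exists2 K : nat, (0 < K)%N & c ^+ K * tau < 1.
  have /andP[c0 c1] := c01.
  have /cvgr0_norm_lt/(_ tau^-1)[|K _ /(_ K.+1 (leqnSn _))/= cK] :
    (c ^+ m) @[m --> \oo] --> (0 : R) by apply: cvg_expr; rewrite ger0_norm.
    by rewrite invr_gt0.
  exists K.+1 => //; rewrite -ltr_pdivlMr// mul1r.
  by rewrite ger0_norm ?exprn_ge0 in cK.
pose J := (Num.truncn (4 * K%:R / alpha)).+1.
have KJ : 4 * K%:R <= alpha * J%:R.
  by rewrite [leRHS]mulrC -ler_pdivrMr// ltW ?truncnS_gt.
(* The index from which the digit sums are large depends on [x]; fixing it splits [E r alpha] into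
   countably many sets, each with uniform coverings. *)
pose A N := [set x : R | (0 < x <= 1)%R /\ forall m, (N <= m)%N ->
    (K * (2 * J * m) <= digit_sum (2 * J * m) x)%N].
have EA : E r alpha `<=` \bigcup_N A N.
  move=> x Ex; have [N xN] := digit_sum_superlinear r1 al0 (ltn0Sn _) KJ Ex.
  by exists N => //; split=> //; case: Ex.
apply/eqP; rewrite eq_le hausdorff_content_ge0 andbT.
apply: le_trans (hausdorff_content_mono _ _ EA) _.
rewrite hausdorff_content_bigcup_eq0// => N.
apply: (@hausdorff_content_geometric_eq0 s ((c ^+ K * tau) ^+ (2 * J)) delta
  (fun m => K * (2 * J * m))%N N) => //.
- have /andP[c0 _] := c01.
  have q0 : 0 <= c ^+ K * tau by rewrite mulr_ge0 ?exprn_ge0 ?(ltW tau0).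
  by rewrite exprn_ge0//= exprn_ilt1.
- by move=> m; rewrite mulnA leq_pmull// !muln_gt0 K0.
move=> m Nm; rewrite -exprM exprMn -exprM.
apply: digit_sum_cover_subset (ltW s0) tau1 _.
by move=> x [x01 xN]; split=> //; exact: xN.
Qed.

End UpperBounds.

(** * Sparse sequences with a prescribed running maximum *)

Definition jump (M : nat -> nat) (n : nat) : nat :=
  if (M n < M n.+1)%N then M n.+1 else 0.

Section Jumps.
Variable M : nat -> nat.
Hypotheses (M0 : M 0 = 0%N) (M_homo : {homo M : m n / (m <= n)%N}).

Lemma bigmax_jump n : (\max_(i < n) jump M i)%N = M n.
Proof.
elim: n => [|n IHn]; first by rewrite big_ord0.
rewrite big_ord_recr/= IHn /jump; have := M_homo (leqnSn n).
by case: ifP; lia.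
Qed.

(** The hypotheses make [c n] at least the number of jumps of [M] before [n], and each jump value is
    at most [M n]. *)
Lemma sum_jump (c : nat -> nat) n : {homo c : m n / (m <= n)%N} ->
  (forall n, (M n < M n.+1)%N -> (c n < c n.+1)%N) ->
  (\sum_(i < n) jump M i <= M n * c n)%N.
Proof.
move=> c_homo Mc; elim: n => [|n IHn]; first by rewrite big_ord0.
have MS := M_homo (leqnSn n); have cS := c_homo _ _ (leqnSn n).
rewrite big_ord_recr/= /jump; case: ifPn => [/Mc cn|_]; last first.
  by rewrite addn0 (leq_trans IHn)// leq_mul.
apply: leq_trans (leq_mul (leqnn (M n.+1)) cn).
by rewrite mulnS addnC leq_add2l (leq_trans IHn)// leq_mul.
Qed.

End Jumps.

(** * Sequences of polynomial growth *)

Section PowerGrowth.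
Context {R : realType}.
Local Open Scope classical_set_scope.
Implicit Types (p r e : R) (f g : nat -> nat).

(** This is f(n) = O(n^p); the shift to [n.+1] keeps the bound meaningful at [n = 0], where [powR]
    would vanish for [p != 0]. *)
Definition power_bounded p f :=
  exists2 C : R, 0 <= C & forall n, (f n)%:R <= C * n.+1%:R `^ p.

Lemma power_bounded_sublinear p f e : p < 1 -> 0 < e -> power_bounded p f ->
  exists c : R, forall n, (f n)%:R <= e * n%:R + c.
Proof.
move=> p1 e0 [C C0 fC].
(* From [N] on, [p < 1] lets [e * n.+1] dominate the power bound; below [N], that bound is at most
   [C * (1 + N)]. *)
pose N : R := (C / e) `^ (1 - p)^-1.
have N0 : 0 <= N by exact: powR_ge0.
have p1' : 0 < 1 - p by rewrite subr_gt0.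
exists (e + C * (1 + N)) => n; apply: le_trans (fC n) _.
have n0 : (0 : R) < n.+1%:R by rewrite ltr0n.
have [Nn|nN] := leP N n.+1%:R.
  have Ce : C / e <= n.+1%:R `^ (1 - p).
    have -> : C / e = N `^ (1 - p).
      by rewrite /N -powRrM mulVf ?lt0r_neq0// powRr1// divr_ge0// ltW.
    by apply: ge0_ler_powR; rewrite ?nnegrE ?(ltW p1').
  rewrite ler_pdivrMr// in Ce.
  have := ler_wpM2r (powR_ge0 n.+1%:R p) Ce.
  have -> : n.+1%:R `^ (1 - p) * e * n.+1%:R `^ p = e * n.+1%:R.
    rewrite mulrAC -powRD ?subrK; last by rewrite gt_eqF ?implybT.
    by rewrite powRr1// mulrC.
  move/le_trans; apply; rewrite -natr1 mulrDr mulr1 addrA lerDl.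
  by rewrite mulr_ge0// addr_ge0.
rewrite addrA ler_wpDl ?addr_ge0 ?mulr_ge0 ?(ltW e0)//.
apply: ler_wpM2l => //.
have [p0|p0] := leP p 0.
  rewrite (@le_trans _ _ 1) ?lerDl//.
  by rewrite -[leRHS](powRr0 n.+1%:R); apply: ler_powR => //; rewrite ler1n.
apply: (@le_trans _ _ n.+1%:R); last by rewrite ltW// ltr_wpDl.
by rewrite -[leRHS]powRr1 ?ler0n//; apply: ler_powR; rewrite ?ler1n// ltW.
Qed.

Lemma power_boundedD p f g : power_bounded p f -> power_bounded p g ->
  power_bounded p (fun n => f n + g n)%N.
Proof.
move=> [C C0 fC] [D D0 gD]; exists (C + D); first by rewrite addr_ge0.
by move=> n; rewrite natrD mulrDl lerD.
Qed.

Lemma power_bounded_le p f g : (forall n, (f n <= g n)%N) ->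
  power_bounded p g -> power_bounded p f.
Proof.
by move=> fg [C C0 gC]; exists C => // n; rewrite (le_trans _ (gC n))// ler_nat.
Qed.

Lemma power_boundedS p f : 0 <= p -> power_bounded p f ->
  power_bounded p (fun n => f n.+1).
Proof.
move=> p0 [C C0 fC]; exists (C * 2 `^ p); first by rewrite mulr_ge0 ?powR_ge0.
move=> n; rewrite (le_trans (fC _))// -mulrA ler_wpM2l// -powRM//.
apply: ge0_ler_powR; rewrite ?nnegrE ?mulr_ge0// -natrM ler_nat; lia.
Qed.

Lemma power_bounded_log p : 0 < p ->
  power_bounded p (fun n => (up_log 2 n.+2).*2.+1).
Proof.
move=> p0; have ln20 : 0 < ln 2 :> R by rewrite ln_gt0// ltr1n.
(* The constant comes from [2 ^ u.-1 < n.+2 <= 2 * n.+1] and from ln z <= z at z = (2(n + 1))^p,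
   after division by [p * ln 2]. *)
pose D : R := 2 `^ p / (p * ln 2).
have D0 : 0 <= D by rewrite divr_ge0 ?powR_ge0 ?mulr_ge0 ?(ltW p0) ?(ltW ln20).
exists (2 * D + 3); first by lra.
move=> n; set u := up_log 2 n.+2.
have u0 : (0 < u)%N by rewrite up_log_gt0.
have un : (2 ^ u.-1 < n.+2)%N by rewrite up_log_gtn.
have n1 : (1 : R) <= n.+1%:R `^ p.
  by rewrite -[leLHS](powRr0 n.+1%:R); apply: ler_powR; rewrite ?ler1n// ltW.
have uD : u.-1%:R <= D * n.+1%:R `^ p.
  rewrite /D mulrAC -powRM// ler_pdivlMr ?mulr_gt0//.
  apply: (@le_trans _ _ (ln ((2 * n.+1%:R) `^ p))); last first.
    by apply/ltW/ln_sublinear; rewrite powR_gt0// mulr_gt0.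
  have lnu : u.-1%:R * ln 2 = ln (2 ^+ u.-1) :> R by rewrite lnXn// mulr_natl.
  rewrite ln_powR mulrCA ler_pM2l// lnu ler_ln ?posrE ?exprn_gt0 ?mulr_gt0//.
  rewrite -natrX -natrM ler_nat; lia.
rewrite -natr1 -mul2n natrM -{1}(prednK u0) -natr1.
by move: uD n1; lra.
Qed.

Lemma natr_powRN_cvg0 e : 0 < e -> n%:R `^ (- e) @[n --> \oo] --> (0 : R).
Proof.
move=> e0; apply/cvgr0Pnorm_lt => d d0.
near=> n.
have dn : d^-1 `^ e^-1 < n%:R by near: n; exact: nbhs_infty_gtr.
have n0 : (0 : R) < n%:R by rewrite (le_lt_trans (powR_ge0 _ _) dn).
rewrite ger0_norm ?powR_ge0// powRN invf_plt ?posrE ?powR_gt0//.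
have -> : d^-1 = (d^-1 `^ e^-1) `^ e.
  by rewrite -powRrM mulVf ?lt0r_neq0// powRr1// invr_ge0 ltW.
by apply: gt0_ltr_powR; rewrite ?nnegrE ?powR_ge0 ?(ltW n0).
Unshelve. all: by end_near. Qed.

Lemma power_bounded_cvg0 p r f : p < r -> power_bounded p f ->
  (f n)%:R / n%:R `^ r @[n --> \oo] --> (0 : R).
Proof.
move=> pr [C C0 fC].
(* For [n >= 1] the quotient [n.+1 / n] lies between 1 and 2, so its [p]-th power is at most 2^|p|
   for either sign of [p]. *)
pose D := C * 2 `^ `|p|.
apply: (@squeeze_cvgr _ _ _ _ (fun=> 0) (fun n => D * n%:R `^ (- (r - p)))).
- near=> n.
  have n0 : (0 < n)%N by near: n; exact: nbhs_infty_gt.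
  have n0R : (0 : R) < n%:R by rewrite ltr0n.
  rewrite divr_ge0 ?powR_ge0//= ler_pdivrMr ?powR_gt0// -mulrA -powRD; last first.
    by rewrite (gt_eqF n0R) implybT.
  rewrite opprB subrK (le_trans (fC n))// /D -mulrA ler_wpM2l//.
  have -> : n.+1%:R = (n.+1%:R / n%:R) * n%:R :> R by rewrite mulfVK ?gt_eqF.
  rewrite powRM ?divr_ge0//; apply: ler_wpM2r; first exact: powR_ge0.
  have q1 : 1 <= n.+1%:R / n%:R :> R by rewrite ler_pdivlMr// mul1r ler_nat.
  apply: (@le_trans _ _ ((n.+1%:R / n%:R) `^ `|p|)).
    by apply: ler_powR => //; exact: ler_norm.
  apply: ge0_ler_powR; rewrite ?nnegrE ?divr_ge0//.
  by rewrite ler_pdivrMr// -natrM ler_nat; lia.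
- exact: cvg_cst.
- rewrite -[X in _ --> X](mulr0 D); apply: cvgMr.
  by apply: natr_powRN_cvg0; rewrite subr_gt0.
Unshelve. all: by end_near. Qed.

End PowerGrowth.

(** * Lower bound for the dimension in the case [r < 1] *)

Section LowerBound.
Context {R : realType}.
Local Open Scope classical_set_scope.
Implicit Types (x y r alpha s : R) (A : set R).

(** If two points share exactly their first [i] digits, with sum S, their distance is at most 2^(-S)
    and that of their shifted images at least 2^(-(S + e)), where e <= (1 - s) i + c <= (1 - s) S +
    c. Hence s (S + e) <= S + c, and the inverse of the shift is [s]-Hoelder with constant 2^c. *)
Lemma hausdorff_content_shift_digits s (c : R) (a b : nat -> nat) A :
  0 <= s < 1 -> 0 <= c ->
  (forall i, (b i + b i.+1 + \sum_(j < i.+2) a j)%N%:R <= (1 - s) * i%:R + c) ->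
  (forall x, 0 < x <= 1 ->
    (forall i, (a i <= digit i.+1 x <= a i + b i)%N) -> A x) ->
  (hausdorff_content 1 (2 `^ c)
    [set y : R | (0 < y <= 1)%R /\ forall i, (digit i.+1 y <= b i)%N] <=
   (2 `^ c)%:E * hausdorff_content s 1 A)%E.
Proof.
move=> /andP[s0 s1] c0 hc aA; set Y := [set y | _].
have [g gP] : {g : R -> R & forall y, 0 < y <= 1 -> 0 < g y <= 1 /\
    forall i, digit i.+1 (g y) = (a i + digit i.+1 y)%N}.
  pose P y x := 0 < y <= 1 -> 0 < x <= 1 /\
    forall i, digit i.+1 x = (a i + digit i.+1 y)%N.
  apply: (@choice _ _ P) => y; rewrite /P.
  have [y01|] := boolP (0 < y <= 1); last by exists 0.
  have [i|x x01 xe] := @expansion_exists R (fun i => a i + digit i.+1 y)%N.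
    by rewrite addn_gt0 digit_gt0// orbT.
  by exists x => _; split=> // i; rewrite -(expansion_uniq xe).
have C0 : (0 : R) < 2 `^ c by rewrite powR_gt0.
have pow2N (n : nat) : (2 ^- n : R) = 2 `^ (- n%:R) by rewrite powR_invn.
have holder i y y' : Y y -> Y y' ->
    (forall j, (j < i)%N -> digit j.+1 y = digit j.+1 y') ->
    (digit i.+1 y < digit i.+1 y')%N -> `|y - y'| <= 2 `^ c * `|g y - g y'| `^ s.
  move=> [y01 yb] [y'01 y'b] agree lti.
  have [x01 xd] := gP _ y01; have [x'01 x'd] := gP _ y'01.
  apply: le_trans (dist_common_digits y01 y'01 agree) _.
  have lower : 2 ^- digit_sum i.+2 (g y) <= g y - g y'.
    apply: dist_first_diff => // [j ji|]; first by rewrite xd x'd agree.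
    by rewrite xd x'd ltn_add2l.
  have dsE : digit_sum i.+2 (g y) =
      (digit_sum i y + (digit i.+1 y + digit i.+2 y + \sum_(j < i.+2) a j))%N.
    rewrite /digit_sum; under eq_bigr do rewrite xd.
    by rewrite big_split/= addnC !addnA; congr (_ + _)%N; rewrite !big_ord_recr.
  apply: (@le_trans _ _ (2 `^ c * (2 ^- digit_sum i.+2 (g y)) `^ s)); last first.
    rewrite ler_pM2l//; apply: ge0_ler_powR; rewrite ?nnegrE ?invr_ge0 ?exprn_ge0//.
    by rewrite (le_trans lower)// ler_norm.
  rewrite !pow2N -powRrM -powRD ?pnatr_eq0 ?implybT//.
  apply: ler_powR; first by rewrite ler1n.
  rewrite mulNr lerNl opprD opprK addrC lerBlDr dsE natrD.
  have iS : i%:R <= (digit_sum i y)%:R :> R by rewrite ler_nat digit_sum_ge.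
  have hi : (digit i.+1 y + digit i.+2 y + \sum_(j < i.+2) a j)%N%:R <=
      (1 - s) * i%:R + c.
    by rewrite (le_trans _ (hc i))// ler_nat leq_add2r leq_add.
  have s1' : 0 <= 1 - s by rewrite subr_ge0 ltW.
  have := ler_wpM2l s1' iS.
  have := ler_piMl (ler0n R (digit i.+1 y + digit i.+2 y + \sum_(j < i.+2) a j)) (ltW s1).
  by move: hi; lra.
have := @hausdorff_content_holder _ s 1 _ 1 (2 `^ c) A Y g s0 ler01 C0.
rewrite powR1 (powRr1 (ltW C0)) !mulr1; apply=> //.
- move=> y [y01 yb]; have [x01 xd] := gP _ y01; apply: aA => // i.
  by rewrite xd leq_addr leq_add2l yb.
move=> y y' Yy Yy'.
have [->|yy'] := eqVneq y y'.
  by rewrite subrr normr0 mulr_ge0 ?powR_ge0.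
have [i di] : exists i, digit i.+1 y != digit i.+1 y'.
  apply: contrapT => /forallNP yE; move/eqP: yy'; apply.
  apply: digit_inj; [exact: Yy.1|exact: Yy'.1|] => i.
  by apply/eqP/negPn/negP.
have [k dk mink] := ex_minnP (ex_intro (fun i => digit i.+1 y != digit i.+1 y') i di).
have agree j : (j < k)%N -> digit j.+1 y = digit j.+1 y'.
  move=> jk; apply/eqP; apply: contraTT jk => /mink; rewrite -leqNgt//.
move: dk; rewrite neq_ltn => /orP[|] ltk; first exact: (holder k).
by rewrite distrC [`|g y - _|]distrC; apply: (holder k) => // j /agree ->.
Qed.

(** Each term is at most half of 1/(i + 2)^2, hence at most half of the telescoping difference 1/(i
    + 1) - 1/(i + 2). *)
Lemma sum_bounded_log n :
  \sum_(0 <= i < n) (2 : R) ^- (up_log 2 i.+2).*2.+1 <= 2^-1.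
Proof.
suff : \sum_(0 <= i < n) (2 : R) ^- (up_log 2 i.+2).*2.+1 <= 2^-1 * (1 - n.+1%:R^-1).
  move/le_trans; apply; rewrite ler_piMr// gerBl//.
elim: n => [|n IHn]; first by rewrite big_nil invr1 subrr mulr0.
rewrite big_nat_recr//=; apply: le_trans (lerD IHn (lexx _)) _.
set u := up_log 2 n.+2.
have un : n.+2%:R <= 2 ^+ u :> R by rewrite -natrX ler_nat up_logP.
have -> : 2 ^- u.*2.+1 = 2^-1 * (2 ^- u * 2 ^- u) :> R.
  by rewrite exprS -addnn exprD !invfM.
have n1 : (0 : R) < n.+1%:R by rewrite ltr0n.
have n2 : (0 : R) < n.+2%:R by rewrite ltr0n.
rewrite -mulrDr ler_pM2l//.
apply: (@le_trans _ _ (1 - n.+1%:R^-1 + n.+2%:R^-1 * n.+2%:R^-1)).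
  rewrite lerD2l; apply: ler_pM; rewrite ?invr_ge0 ?exprn_ge0//;
  by rewrite lef_pV2 ?posrE ?exprn_gt0.
have nn : n.+2%:R = n.+1%:R + 1 :> R by rewrite natr1.
have : n.+1%:R^-1 - n.+2%:R^-1 = n.+1%:R^-1 * n.+2%:R^-1 :> R.
  rewrite nn; move: (n.+1%:R) n1 => p p0; field.
  by rewrite !gt_eqF// addr_gt0.
have : n.+2%:R^-1 * n.+2%:R^-1 <= n.+1%:R^-1 * n.+2%:R^-1 :> R.
  by rewrite ler_pM2r ?invr_gt0// lef_pV2 ?posrE// ler_nat.
by move: (n.+1%:R^-1) (n.+2%:R^-1) => p w; clear; lra.
Qed.

Lemma hausdorff_dim_sublinear r alpha : 0 < r < 1 -> 0 < alpha ->
  hausdorff_dim (E r alpha) = 1%E.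
Proof.
move=> /andP[r0 r1] al0; apply/eqP; rewrite eq_le hausdorff_dim_le1/=; last first.
  by move=> x [].
apply: hausdorff_dim_ge => s /andP[s0 s1].
(* Large enough to keep [r + r / k], the growth exponent of the partial sums of [a] below, under
   1. *)
pose k := (Num.truncn (2 * r / (1 - r))).+1.
have k0 : (0 : R) < k%:R by rewrite ltr0n.
have kr : r + r / k%:R <= (1 + r) / 2.
  have r1' : 0 < 1 - r by rewrite subr_gt0.
  suff : r / k%:R <= (1 - r) / 2 by lra.
  rewrite ler_pdivrMr//; have : 2 * r / (1 - r) < k%:R by exact: truncnS_gt.
  by rewrite ltr_pdivrMr//; lra.
pose q := r / k%:R.
have q0 : 0 < q by rewrite divr_gt0.
have qk : q * k%:R = r by rewrite /q mulfVK// gt_eqF.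
(* Rounding in two stages lets [M] jump only where [c] does, about n^q times, while [M] still grows
   like alpha n^r. Truncating alpha n^r directly would give about n^r jumps, too many when r >=
   1/2. *)
pose c n := Num.truncn (n%:R `^ q : R).
pose M n := Num.truncn (alpha * (c n)%:R ^+ k).
pose b n := (up_log 2 n.+2).*2.+1.
have cn n : (c n)%:R <= n%:R `^ q :> R by rewrite truncn_le ?powR_ge0.
have Mn n : (M n)%:R <= alpha * n%:R `^ r.
  apply: (@le_trans _ _ (alpha * (c n)%:R ^+ k)).
    by rewrite truncn_le// mulr_ge0 ?exprn_ge0// ltW.
  rewrite ler_pM2l// -qk powRrM powR_mulrn ?powR_ge0//.
  by rewrite ler_pXn2r ?nnegrE ?powR_ge0.
have c_homo : {homo c : m n / (m <= n)%N}.
  move=> m n mn; apply: le_truncn; apply: ge0_ler_powR; rewrite ?nnegrE ?(ltW q0)//.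
  by rewrite ler_nat.
have Mc m n : (c m <= c n)%N -> (M m <= M n)%N.
  move=> mn; apply: le_truncn; rewrite ler_pM2l// lerXn2r ?nnegrE//.
  by rewrite ler_nat.
have M_homo : {homo M : m n / (m <= n)%N} by move=> m n /c_homo/Mc.
have M0 : M 0%N = 0%N.
  rewrite /M /c powR0 ?gt_eqF// truncn0 expr0n/= mulr0 truncn0//.
have b_bd : power_bounded (r / 2) b by apply: power_bounded_log; rewrite divr_gt0.
pose a := jump M.
have a_bd : power_bounded ((1 + r) / 2) (fun n => \sum_(i < n) a i)%N.
  apply: (@power_bounded_le _ _ _ (fun n => M n * c n)%N).
    move=> n; apply: sum_jump => // m; apply: contraTT; rewrite -!leqNgt.
    exact: Mc.
  exists alpha; first exact: ltW.
  move=> n; have n1 : (1 : R) <= n.+1%:R by rewrite ler1n.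
  have up (p : R) : 0 < p -> n%:R `^ p <= n.+1%:R `^ p.
    move=> p0; apply: ge0_ler_powR; rewrite ?nnegrE ?(ltW p0)//.
    by rewrite ler_nat.
  rewrite natrM; apply: (@le_trans _ _ ((alpha * n.+1%:R `^ r) * n.+1%:R `^ q)).
    apply: ler_pM => //; last by rewrite (le_trans (cn n))// up.
    by rewrite (le_trans (Mn n))// ler_pM2l// up.
  rewrite -mulrA ler_pM2l// -powRD; last by rewrite pnatr_eq0 implybT.
  exact: ler_powR.
have [c0 hc] : exists c0 : R, forall i,
    (b i + b i.+1 + \sum_(j < i.+2) a j)%N%:R <= (1 - s) * i%:R + c0.
  apply: (@power_bounded_sublinear _ ((1 + r) / 2)); [lra|lra|].
  have bb : power_bounded ((1 + r) / 2) b by apply: power_bounded_log; lra.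
  have p0 : 0 <= (1 + r) / 2 by lra.
  apply: power_boundedD.
    by apply: power_boundedD => //; exact: power_boundedS.
  have := power_boundedS p0 (power_boundedS p0 a_bd); exact.
have EP x : 0 < x <= 1 -> (forall i, (a i <= digit i.+1 x <= a i + b i)%N) ->
    E r alpha x.
  move=> x01 xab; split=> //.
  (* Digits exceed the terms of [a] by at most [b], which is nondecreasing, so the maximum exceeds
     [M n] by at most [b n], which is logarithmic. *)
  have MLb n : (M n <= maxdigit n x <= M n + b n)%N.
    rewrite maxdigitE -(bigmax_jump M0 M_homo); apply/andP; split.
      apply/bigmax_leqP => i _; apply: leq_trans (leq_bigmax i).
      by case/andP: (xab i).
    apply/bigmax_leqP => i _; have /andP[_ /leq_trans->]//:= xab i.
    by rewrite leq_add ?(leq_bigmax i)// ltnS leq_double leq_up_log// !ltnS ltnW.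
  (* Each truncation loses at most 1: c(n) >= n^q - 1 and M(n) >= alpha c(n)^k - 1; the lower bound
     divides these by n^r = (n^q)^k. *)
  apply: (@squeeze_cvgr _ _ _ _
    (fun n => alpha * (1 - n%:R `^ (- q)) ^+ k - n%:R `^ (- r))
    (fun n => alpha + (b n)%:R / n%:R `^ r)).
  - near=> n.
    have n0 : (0 < n)%N by near: n; exact: nbhs_infty_gt.
    have n0R : (0 : R) < n%:R by rewrite ltr0n.
    have nr0 : 0 < n%:R `^ r :> R by rewrite powR_gt0.
    have nq0 : 0 < n%:R `^ q :> R by rewrite powR_gt0.
    have nq1 : 1 <= n%:R `^ q :> R.
      by rewrite -[leLHS](powRr0 n%:R); apply: ler_powR; rewrite ?ler1n// ltW.
    have /andP[ML Lb] := MLb n; apply/andP; split.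
      rewrite ler_pdivlMr//; apply: (@le_trans _ _ (M n)%:R); last by rewrite ler_nat.
      have nqc : n%:R `^ q - 1 <= (c n)%:R.
        by rewrite lerBlDr natr1 ltW ?truncnS_gt.
      have cM : alpha * (c n)%:R ^+ k - 1 <= (M n)%:R.
        by rewrite lerBlDr natr1 ltW ?truncnS_gt.
      apply: le_trans cM; rewrite mulrBl !powRN mulVf ?gt_eqF// lerD2r.
      rewrite -mulrA ler_pM2l//.
      have -> : n%:R `^ r = (n%:R `^ q) ^+ k.
        by rewrite -qk powRrM powR_mulrn ?powR_ge0.
      rewrite -exprMn mulrBl mul1r mulVf ?gt_eqF//.
      by rewrite lerXn2r ?nnegrE ?subr_ge0.
    rewrite ler_pdivrMr// mulrDl mulfVK ?gt_eqF//.
    by apply: (@le_trans _ _ (M n + b n)%N%:R); rewrite ?ler_nat// natrD lerD2r.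
  - rewrite -[X in _ --> X](_ : alpha * (1 - 0) ^+ k - 0 = alpha); last first.
      by rewrite !subr0 expr1n mulr1.
    apply: cvgB; last exact: natr_powRN_cvg0.
    apply: cvgMr; have := natr_powRN_cvg0 q0.
    move/(cvgB (cvg_cst (1 : R))) => H.
    exact: (cvg_comp _ _ H (@exprn_continuous R k (1 - 0))).
  - rewrite -[X in _ --> X]addr0; apply: cvgD; first exact: cvg_cst.
    apply: (@power_bounded_cvg0 _ (r / 2)) => //; lra.
(* Nonnegativity of [C] makes the scale 2^C at least 1, as the content bound for bounded digits
   requires. *)
pose C := Num.max 0 c0.
have C0 : 0 <= C by rewrite le_max lexx.
have hC i : (b i + b i.+1 + \sum_(j < i.+2) a j)%N%:R <= (1 - s) * i%:R + C.
  by rewrite (le_trans (hc i))// lerD2l le_max lexx orbT.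
have s01 : 0 <= s < 1 by rewrite s0.
have := hausdorff_content_shift_digits s01 C0 hC EP.
have C1 : 1 <= 2 `^ C :> R.
  by rewrite -[leLHS](powRr0 2); apply: ler_powR; rewrite ?ler1n.
(* This leaves 1 - 1/2 <= 2^C times the [s]-content of [E r alpha], which a zero [s]-measure would
   contradict. *)
move/(le_trans (bounded_digits_content C1 sum_bounded_log)) => lower.
apply/eqP => E0.
have cE0 : hausdorff_content s 1 (E r alpha) = 0%E.
  apply/eqP; rewrite eq_le hausdorff_content_ge0 andbT -E0.
  exact: hausdorff_content_le_measure.
move: lower; rewrite cE0 mule0 lee_fin; lra.
Unshelve. all: by end_near. Qed.

End LowerBound.

Unset Implicit Arguments.

Theorem theorem1p4 (R : realType) (r alpha : R) (hr : 0 < r) (halpha : 0 < alpha) :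
  hausdorff_dim (E r alpha) = (if r < 1 then 1 else 0)%:E.
Proof.
have [r1|r1] := ltP r 1; last exact: hausdorff_dim_superlinear.
by apply: hausdorff_dim_sublinear; rewrite // hr.
Qed.
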